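(* Let $$\ell = \left\lceil \exp\left(\frac{25046441}{116352}\right) \right\rceil .$$ Then there exists an integer $k$ with $1 \leq k \leq \ell!$ such that the reduced D'Arcais polynomial $R_k^\sigma(X) = P_k^\sigma(X)/X$ is not a Hurwitz polynomial.
   Context: Let $\sigma(n) = \sum_{d \mid n} d$. The D'Arcais polynomials $P_n^\sigma(X)$, $n \ge 0$, are defined by the identity of formal power series in $q$ $$\sum_{n=0}^\infty P_n^\sigma(X) q^n = \prod_{m=1}^\infty (1 - q^m)^{-X} = \exp\Big( X \sum_{j=1}^\infty \sigma(j) \frac{q^j}{j} \Big).$$ For $n \geq 1$, $P_n^\sigma(X)$ is a polynomial of degree $n$ with zero constant term, and the reduced D'Arcais polynomial is $R_n^\sigma(X) := P_n^\sigma(X)/X$; it has degree $n-1$ and strictly positive coefficients. A polynomial with positive real coefficients is called a Hurwitz polynomial if all its complex zeros lie in the open left half-plane $\{z \in \mathbb{C} : \Re(z) < 0\}$ (a nonzero constant is vacuously Hurwitz). *)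

(* Defs.v *)
From HB Require Import structures.
From mathcomp Require Import all_boot all_order all_algebra.
From mathcomp Require Import complex.
From mathcomp Require Import reals sequences exp.

Set Implicit Arguments.
Unset Strict Implicit.
Unset Printing Implicit Defensive.

Import Order.TTheory GRing.Theory Num.Theory.
Local Open Scope ring_scope.

(* The series \sum_n f n * q^n over A is represented by its coefficients. *)
Definition fps (A : nzRingType) : Type := nat -> A.

Definition fps_one (A : nzRingType) : fps A := fun n => (n == 0%N)%:R.

Definition fps_mul (A : nzRingType) (f g : fps A) : fps A :=
  fun n => \sum_(i < n.+1) f i * g (n - i)%N.

Definition fps_pow (A : nzRingType) (f : fps A) (k : nat) : fps A :=
  iter k (fps_mul f) (fps_one A).

(* exp f = \sum_k f^k / k! for f without constant term: f^k is then divisible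
   by q^k, so only the indices k <= n contribute to the coefficient of q^n. *)
Definition fps_exp (F : numFieldType) (f : fps {poly F}) : fps {poly F} :=
  fun n => \sum_(k < n.+1) (k`!%:R)^-1 *: fps_pow f k n.

Definition sigma (n : nat) : nat := \sum_(d <- divisors n) d.

(* The series X * \sum_(j >= 1) sigma j * q^j / j; its constant term is
   zero because 0^-1 = 0 (the junk value sigma 0 = 1 plays no role). *)
Definition darcais_exponent (F : numFieldType) : fps {poly F} :=
  fun j => ((sigma j)%:R / j%:R) *: 'X.

(* The coefficients of exp (X * \sum_(j >= 1) sigma j * q^j / j), that is, of
   \prod_(m >= 1) (1 - q^m)^(-X). *)
Definition darcais (F : numFieldType) (n : nat) : {poly F} :=
  fps_exp (darcais_exponent F) n.

(* For n >= 1 the Euclidean division by 'X is exact, see darcaisE. *)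
Definition reduced_darcais (F : numFieldType) (n : nat) : {poly F} :=
  darcais F n %/ 'X.

Lemma darcaisE (F : numFieldType) n :
  (0 < n)%N -> darcais F n = reduced_darcais F n * 'X.
Proof.
move=> n0; rewrite /reduced_darcais divpK //.
rewrite -[X in X %| _]subr0 -polyC0 dvdp_XsubCl /root.
rewrite /darcais /fps_exp horner_sum big1 // => k _.
rewrite hornerZ; case: (nat_of_ord k) => [|j] /=.
  by rewrite /fps_one eqn0Ngt n0 hornerC mulr0.
by rewrite /fps_mul horner_sum big1 ?mulr0 // => i _;
  rewrite /darcais_exponent hornerM hornerZ hornerX mulr0 mul0r.
Qed.

(* Only the condition on the zeros is recorded; positivity of the coefficients
   is a restriction on the polynomials p to which the notion is applied, and
   reduced_darcais R n satisfies it for n >= 1. *)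
Definition hurwitz (R : rcfType) (p : {poly R}) : Prop :=
  forall z : R[i], root (map_poly (real_complex R) p) z -> complex.Re z < 0.

(* Main.v *)
Require Import Defs.
From HB Require Import structures.
From mathcomp Require Import all_boot all_order all_algebra.
From mathcomp Require Import complex.
From mathcomp Require Import reals sequences exp.
From mathcomp Require Import ring lra zify.

Set Implicit Arguments.
Unset Strict Implicit.
Unset Printing Implicit Defensive.

Import Order.TTheory GRing.Theory Num.Theory.
Local Open Scope ring_scope.

(* If all zeros of a real polynomial a_0 + a_1 X + ... have negative real part,
   then a_0 a_3 <= a_1 a_2. For R_n the coefficient a_k is 1/(k+1)! times the
   (k+1)-fold additive convolution at n of s(i) = sigma(i)/i. The convolutions
   are of order n^k up to absolute constants: from below because s >= 1, from
   above because the mean square of s over i <= n is at most 4. In the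
   inequality the powers of n cancel, so that s(n) = a_0 is bounded by about 192
   for large n.
   On the other hand s(l!) is at least the harmonic sum 1 + 1/2 + ... + 1/l,
   hence at least log l >= 25046441/116352 > 215. *)

(** * A necessary condition on the first four coefficients of a Hurwitz polynomial *)

Section Hurwitz.
Local Open Scope complex_scope.
Variable R : rcfType.
Implicit Types (p q : {poly R}) (b c : R).

Lemma hurwitz_divisor p q : q %| p -> hurwitz p -> hurwitz q.
Proof.
move=> /dvdpP [r ->] hp z zq; apply: hp.
by rewrite rmorphM /= rootM zq orbT.
Qed.

(* The sign of a_0 a_1 makes the condition stable under multiplication by
   the real factors of a Hurwitz polynomial. *)
Definition minor_ge0 p := 0 <= p`_0 * p`_1 /\ p`_0 * p`_3 <= p`_1 * p`_2.

(** For low coefficients x, y, z, t of [p], the product has minor x y + b y^2 + b^2 (y z - x t): the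
    sign of x y is what makes the first term harmless. *)
Lemma minor_ge0_linear p b : 0 <= b -> minor_ge0 p -> minor_ge0 (p * ('X + b%:P)).
Proof.
move=> b0 [h1 h2]; rewrite /minor_ge0 !mulrDr !coefD !coefMX !coefMC /=.
move: (p`_0) (p`_1) (p`_2) (p`_3) h1 h2 => x y z t h1 h2.
split.
  have := mulr_ge0 (sqr_ge0 b) h1; have := mulr_ge0 b0 (sqr_ge0 x); lra.
have : 0 <= b ^+ 2 * (y * z - x * t) by rewrite mulr_ge0 ?sqr_ge0 ?subr_ge0.
have := mulr_ge0 b0 (sqr_ge0 y); lra.
Qed.

(** Here the new minor is b x^2 + b^2 x y + b c y^2 + c^2 (y z - x t). *)
Lemma minor_ge0_quadratic p b c : 0 <= b -> 0 <= c ->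
  minor_ge0 p -> minor_ge0 (p * ('X^2 + b *: 'X + c%:P)).
Proof.
move=> b0 c0 [h1 h2].
rewrite /minor_ge0 !mulrDr -scalerAr !coefD !coefZ !coefMX !coefMXn !coefMC /=.
move: (p`_0) (p`_1) (p`_2) (p`_3) h1 h2 => x y z t h1 h2.
have bc := mulr_ge0 b0 c0.
split.
  have := mulr_ge0 (sqr_ge0 c) h1; have := mulr_ge0 bc (sqr_ge0 x); lra.
have : 0 <= c ^+ 2 * (y * z - x * t) by rewrite mulr_ge0 ?sqr_ge0 ?subr_ge0.
have := mulr_ge0 bc (sqr_ge0 y); have := mulr_ge0 b0 (sqr_ge0 x).
have := mulr_ge0 (sqr_ge0 b) h1; lra.
Qed.

Lemma hurwitz_factor p : hurwitz p -> (1 < size p)%N ->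
  (exists2 b, 0 <= b & 'X + b%:P %| p) \/
  (exists b c, [/\ 0 <= b, 0 <= c & 'X^2 + b *: 'X + c%:P %| p]).
Proof.
move=> hp sp.
have /closed_rootP [z zp] : size (map_poly (real_complex R) p) != 1%N.
  by rewrite size_map_poly; case: size sp => [|[]].
have hz := hp _ zp.
case: z zp hz => r s /= zp r0.
have [s0|s0] := eqVneq s 0.
  left; exists (- r); first by rewrite oppr_ge0 ltW.
  rewrite polyCN dvdp_XsubCl; move: zp; rewrite s0.
  by rewrite -[_ +i* 0]/(real_complex R r) fmorph_root.
(* The monic real quadratic with zeros r + i s and r - i s. *)
right; exists (- r *+ 2), (r ^+ 2 + s ^+ 2); split.
- by rewrite mulrn_wge0 // oppr_ge0 ltW.
- by rewrite addr_ge0 ?sqr_ge0.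
set q := (X in X %| p).
have sq : size q = 3%N.
  rewrite /q -addrA size_polyDl size_polyXn //.
  rewrite (leq_ltn_trans (size_polyD _ _)) // gtn_max ltnS.
  rewrite (leq_trans (size_scale_leq _ _)) ?size_polyX //.
  by rewrite (leq_ltn_trans (size_polyC_leq1 _)).
have qz : (map_poly (real_complex R) q).[r +i* s] = 0.
  have -> b c : (map_poly (real_complex R) ('X^2 + b *: 'X + c%:P)).[r +i* s] =
      (r * r - s * s + b * r + c) +i* (r * s + s * r + b * s).
    rewrite !rmorphD /= map_polyZ map_polyXn map_polyX map_polyC /=.
    by rewrite !hornerE /= expr2; simpc.
  apply/eqP; rewrite eq_complex /=.
  by apply/andP; split; apply/eqP; ring.
(* The remainder is real of degree at most 1 and vanishes at r + i s with s nonzero: the imaginary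
   part kills its slope, then the real part its constant term. *)
have : (map_poly (real_complex R) (p %% q)).[r +i* s] = 0.
  move/rootP: zp; rewrite {1}(divp_eq p q) rmorphD rmorphM /= hornerD hornerM qz.
  by rewrite mulr0 add0r.
have sm : (size (p %% q)%R <= 2)%N.
  by rewrite -ltnS -sq ltn_modp -size_poly_gt0 sq.
rewrite /dvdp; move: (p %% q) sm => m sm.
have -> : m = m`_1 *: 'X + (m`_0)%:P.
  apply/polyP => -[|[|i]]; rewrite coefD coefZ coefX coefC /= ?mulr0 ?mulr1 ?add0r
    ?addr0 //.
  by rewrite nth_default // (leq_trans sm).
rewrite !rmorphD /= map_polyZ map_polyX map_polyC /= !hornerE /=; simpc.
move/eqP; rewrite eq_complex /= => /andP [/eqP e1 /eqP e2].
have m1 : m`_1 = 0 by move/eqP: e2; rewrite mulf_eq0 (negbTE s0) orbF => /eqP.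
by move: e1; rewrite m1 mul0r add0r => ->; rewrite scale0r polyC0 addr0.
Qed.

(** Induction on the size, splitting off one real factor at a time; the quotient is again
    Hurwitz. *)
Lemma hurwitz_minor p : hurwitz p -> minor_ge0 p.
Proof.
have [n] := ubnP (size p); elim: n p => // n IH p sp hp.
case: (leqP (size p) 1) => [/size1_polyC -> | p1].
  by rewrite /minor_ge0 !coefC /= !mulr0 lexx.
have p0 : p != 0 by rewrite -size_poly_gt0 ltnW.
have step q : (1 < size q)%N -> q %| p ->
    exists r, p = r * q /\ minor_ge0 r.
  move=> q1 qp; exists (p %/ q); split; first by rewrite divpK.
  apply: IH; last first.
    by apply: hurwitz_divisor hp; rewrite -{2}(divpK qp) dvdp_mulIl.
  have q0 : q != 0 by rewrite -size_poly_gt0 ltnW.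
  rewrite (size_divp p q0).
  by move: (size p) (size q) sp p1 q1 => x y *; lia.
case: (hurwitz_factor hp p1) => [[b b0]|[b [c [b0 c0]]]] /step [].
- by rewrite -[b]opprK polyCN size_XsubC.
- by move=> r [-> /(minor_ge0_linear b0)].
- rewrite -addrA size_polyDl size_polyXn // ltnS.
  rewrite (leq_trans (size_polyD _ _)) // geq_max.
  rewrite (leq_trans (size_scale_leq _ _)) ?size_polyX //.
  by rewrite (leq_trans (size_polyC_leq1 _)).
- by move=> r [-> /(minor_ge0_quadratic b0 c0)].
Qed.
End Hurwitz.

(** * The ratio sigma(n)/n: large values at factorials, bounded mean square *)

Section Abundancy.
Variable R : realType.

Definition abundancy (n : nat) : R := (sigma n)%:R / n%:R.

Lemma abundancy0 : abundancy 0 = 0.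
Proof. by rewrite /abundancy invr0 mulr0. Qed.

Lemma abundancy_ge0 n : 0 <= abundancy n.
Proof. by rewrite divr_ge0. Qed.

(** The involution d -> n/d on divisors turns sigma(n)/n into the sum of 1/d. The range up to [N]
    does not depend on [n], so that sums over [n] can be exchanged with it. *)
Lemma abundancyE N n : (0 < n <= N)%N ->
  abundancy n = \sum_(1 <= d < N.+1) (d %| n)%N%:R / d%:R.
Proof.
move=> /andP[n0 nN].
have K d : (d %| n)%N -> (n %/ (n %/ d))%N = d by move=> dn; rewrite divnA // mulKn.
have E : perm_eq (divisors n) [seq (n %/ d)%N | d <- index_iota 1 N.+1 & (d %| n)%N].
  apply: uniq_perm; first exact: divisors_uniq.
    rewrite map_inj_in_uniq ?filter_uniq ?iota_uniq // => x y.
    rewrite !mem_filter => /andP[xn _] /andP[yn _] e.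
    by rewrite -(K x xn) e K.
  move=> d; rewrite -dvdn_divisors //; apply/idP/mapP => [dn|[e]].
    exists (n %/ d)%N; last by rewrite K.
    have dd : (0 < d)%N by apply: dvdn_gt0 dn.
    rewrite mem_filter mem_index_iota ltnS divn_gt0 // (dvdn_leq n0 dn) /=.
    by rewrite (leq_trans (leq_div _ _)) // andbT; apply/dvdnP; exists d;
      rewrite mulnC divnK.
  by rewrite mem_filter => /andP[en _] ->; apply/dvdnP; exists e; rewrite mulnC divnK.
rewrite /abundancy /sigma (perm_big _ E) /= big_map big_filter natr_sum mulr_suml.
rewrite big_mkcond [LHS]big_nat [RHS]big_nat; apply: eq_bigr => d /andP[d0 _].
case: ifP => dn; last by rewrite mul0r.
by rewrite natf_div // mulrAC divff ?pnatr_eq0 -?lt0n.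
Qed.

Lemma abundancy_ge1 n : (0 < n)%N -> 1 <= abundancy n.
Proof.
move=> n0; rewrite (@abundancyE n) ?n0 //= big_ltn ?ltnS // dvd1n divr1 lerDl.
by apply: sumr_ge0 => i _; rewrite divr_ge0.
Qed.

Definition harmonic_sum N : R := \sum_(1 <= d < N.+1) d%:R^-1.

Lemma harmonic_sum_recr N : harmonic_sum N.+1 = harmonic_sum N + N.+1%:R^-1.
Proof. by rewrite /harmonic_sum big_nat_recr. Qed.

(** Every d from 1 to l divides l!. *)
Lemma harmonic_le_abundancy_fact l : harmonic_sum l <= abundancy l`!.
Proof.
rewrite (@abundancyE l`!) ?fact_gt0 ?leqnn //.
have ll : (l.+1 <= l`!.+1)%N.
  by elim: l => // l IH; rewrite ltnS factS -{1}[l.+1]muln1 leq_mul // fact_gt0.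
rewrite (big_cat_nat _ ll) //= -[leLHS]addr0 lerD //; last first.
  by apply: sumr_ge0 => i _; rewrite divr_ge0.
apply: ler_sum_nat => d /andP[d0 dl].
by rewrite dvdn_fact ?d0 // mul1r.
Qed.

(** The product of the factors 1 + 1/k <= exp(1/k) telescopes. *)
Lemma expR_harmonic l : l.+1%:R <= expR (harmonic_sum l).
Proof.
elim: l => [|l IH]; first by rewrite /harmonic_sum big_geq // expR0.
rewrite harmonic_sum_recr expRD.
have -> : l.+2%:R = l.+1%:R * (1 + l.+1%:R^-1) :> R.
  by rewrite mulrDr mulr1 divff ?pnatr_eq0 // natr1.
by apply: ler_pM => //; [rewrite addr_ge0 ?invr_ge0 | rewrite expR_ge1Dx].
Qed.

Lemma harmonic_ge1 N : (0 < N)%N -> 1 <= harmonic_sum N.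
Proof.
case: N => // N _; rewrite /harmonic_sum big_ltn // invr1 lerDl.
by apply: sumr_ge0 => i _; rewrite invr_ge0.
Qed.

(* Bounds the mean of s^2, since at most m / max(d, e) of the i <= m are
   divisible by both d and e; the full double series is 3 zeta(3). *)
Definition pair_sum N : R := \sum_(1 <= d < N.+1) \sum_(1 <= e < N.+1)
  (d%:R * e%:R * (maxn d e)%:R)^-1.

Lemma pair_sum_recr N : pair_sum N.+1 =
  pair_sum N + 2 * harmonic_sum N / N.+1%:R ^+ 2 + (N.+1%:R ^+ 3)^-1.
Proof.
rewrite /pair_sum big_nat_recr //=.
under eq_bigr do rewrite big_nat_recr //=.
rewrite big_split /= [X in _ + _ + X = _]big_nat_recr //= maxnn.
have E : \sum_(1 <= i < N.+1) (i%:R * N.+1%:R * (maxn i N.+1)%:R)^-1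
      = harmonic_sum N / N.+1%:R ^+ 2.
  rewrite /harmonic_sum mulr_suml [LHS]big_nat [RHS]big_nat.
  apply: eq_bigr => i /andP[_ iN].
  by rewrite (maxn_idPr (ltnW iN)) -mulrA invfM -expr2.
have E' : \sum_(1 <= i < N.+1) (N.+1%:R * i%:R * (maxn N.+1 i)%:R)^-1
      = harmonic_sum N / N.+1%:R ^+ 2.
  by rewrite -E; apply: eq_bigr => i _; rewrite maxnC [_%:R * i%:R]mulrC.
by rewrite E E' -expr2 -exprSr; ring.
Qed.

(* The second term dominates the tail of the double series beyond N. *)
Lemma pair_sum_tail_le N : (3 <= N)%N ->
  pair_sum N + (2 * harmonic_sum N + 2) / N%:R <= 4.
Proof.
(* The induction starts at 3 because the left side is 33/8 > 4 at 2. *)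
elim: N => // N IH; rewrite leq_eqVlt => /orP[/eqP [<-]|N3].
  rewrite !pair_sum_recr !harmonic_sum_recr.
  by rewrite /pair_sum /harmonic_sum !big_geq //; lra.
have N0 : (0 < N)%N by case: (N) N3.
apply: le_trans (IH N3); rewrite pair_sum_recr harmonic_sum_recr -[N.+1%:R]natr1.
have h1 : 1 <= harmonic_sum N by apply: harmonic_ge1.
have n0 : 0 < N%:R :> R by rewrite ltr0n.
move: (N%:R) (harmonic_sum N) (pair_sum N) h1 n0 => n h t h1 n0.
have n1 : 0 < n + 1 by rewrite addr_gt0.
rewrite -subr_ge0.
have -> : t + (2 * h + 2) / n - (t + 2 * h / (n + 1) ^+ 2 + ((n + 1) ^+ 3)^-1 +
    (2 * (h + (n + 1)^-1) + 2) / (n + 1))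
  = ((2 * h + 2) * (n + 1) - n) / (n * (n + 1) ^+ 3).
  by field; rewrite !gt_eqF.
rewrite divr_ge0 ?mulr_ge0 ?exprn_ge0 ?ltW //.
by rewrite subr_gt0; nra.
Qed.

Lemma pair_sum_le4 N : pair_sum N <= 4.
Proof.
case: (leqP 3 N) => [/pair_sum_tail_le|]; last first.
  by case: N => [|[|[|]]] // _; rewrite ?pair_sum_recr ?harmonic_sum_recr
    /pair_sum /harmonic_sum !big_geq //; lra.
apply: le_trans; rewrite lerDl divr_ge0 // addr_ge0 // mulr_ge0 //.
by apply: sumr_ge0 => i _; rewrite invr_ge0.
Qed.

(** It suffices to count the multiples of the larger of [d] and [e]. *)
Lemma count_common_multiples m d e : (0 < d)%N -> (0 < e)%N ->
  \sum_(1 <= i < m.+1) ((d %| i)%N%:R * (e %| i)%N%:R) <= m%:R / (maxn d e)%:R :> R.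
Proof.
move=> d0 e0.
have one_le k : (0 < k)%N -> \sum_(1 <= i < m.+1) (k %| i)%N%:R <= m%:R / k%:R :> R.
  move=> k0; rewrite ler_pdivlMr ?ltr0n // -natr_sum -divn_count_dvd -natrM ler_nat.
  exact: leq_trunc_div.
by case: (leqP d e) => _; [apply: le_trans (one_le e e0) | apply: le_trans (one_le d d0)];
  apply: ler_sum => i _; case: (d %| i)%N; case: (e %| i)%N; rewrite ?mulr1 ?mulr0 ?ler01.
Qed.

Lemma sum_abundancy_sqr m : \sum_(1 <= i < m.+1) abundancy i ^+ 2 <= 4 * m%:R.
Proof.
have -> : \sum_(1 <= i < m.+1) abundancy i ^+ 2 =
   \sum_(1 <= d < m.+1) \sum_(1 <= e < m.+1) (d%:R * e%:R)^-1 *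
     \sum_(1 <= i < m.+1) ((d %| i)%N%:R * (e %| i)%N%:R).
  under [RHS]eq_bigr => d _.
    under eq_bigr do rewrite mulr_sumr.
    rewrite exchange_big /=.
    over.
  rewrite [RHS]exchange_big /= [LHS]big_nat [RHS]big_nat; apply: eq_bigr => i im.
  rewrite expr2 (@abundancyE m) // mulr_suml; apply: eq_bigr => d _.
  rewrite mulr_sumr; apply: eq_bigr => e _.
  by rewrite invfM; ring.
apply: (@le_trans _ _ (pair_sum m * m%:R)); last by rewrite ler_wpM2r ?pair_sum_le4.
rewrite /pair_sum mulr_suml; apply: ler_sum_nat => d /andP[d0 _].
rewrite mulr_suml; apply: ler_sum_nat => e /andP[e0 _].
rewrite [X in _ <= X * _]invfM -mulrA ler_wpM2l ?invr_ge0 ?mulr_ge0 //.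
by rewrite mulrC count_common_multiples.
Qed.

Lemma sum_abundancy m : \sum_(1 <= i < m.+1) abundancy i <= 2 * m%:R.
Proof.
(* From (s - 2)^2 >= 0; the mean square 4 then gives mean at most 4/4 + 1 = 2. *)
have : \sum_(1 <= i < m.+1) abundancy i <=
       \sum_(1 <= i < m.+1) (4^-1 * abundancy i ^+ 2 + 1).
  apply: ler_sum => i _; have := sqr_ge0 (abundancy i - 2); lra.
rewrite big_split /= -mulr_sumr sumr_const_nat subSS subn0.
have := sum_abundancy_sqr m; lra.
Qed.
End Abundancy.

(** * Coefficients of the reduced polynomials as convolutions, with two-sided bounds *)

Section Coefficients.
Variable R : realType.
Local Notation s := (@abundancy R).
Local Notation conv k n := (fps_pow (s : fps R) k n).

Lemma fps_pow_darcais_exponent k n :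
  fps_pow (darcais_exponent R) k n = conv k n *: 'X^k.
Proof.
elim: k n => [|k IH] n.
  by rewrite /fps_pow /= /fps_one expr0 scaler_nat.
rewrite /fps_pow !iterS /fps_mul scaler_suml; apply: eq_bigr => i _.
rewrite -/(fps_pow _ _ _) IH /darcais_exponent -scalerAl -scalerAr scalerA.
by rewrite -exprS.
Qed.

(** The j-th power of the exponent is a multiple of X^j, so only j = k + 1 contributes. *)
Lemma coef_reduced_darcais n k : (k < n)%N ->
  (reduced_darcais R n)`_k = conv k.+1 n / k.+1`!%:R.
Proof.
move=> kn; have n0 : (0 < n)%N by apply: leq_ltn_trans kn.
have <- : (darcais R n)`_k.+1 = (reduced_darcais R n)`_k.
  by rewrite darcaisE // coefMX.
rewrite /darcais /fps_exp coef_sum.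
have kn1 : (k.+1 < n.+1)%N by [].
under eq_bigr do rewrite coefZ fps_pow_darcais_exponent coefZ coefXn.
rewrite (bigD1 (Ordinal kn1)) // eqxx mulr1 big1 => [|i ik].
  exact: etrans (addr0 _) (mulrC _ _).
by rewrite (negbTE (_ : k.+1 != i)) ?mulr0 // eq_sym.
Qed.

Lemma fps_powS k n : conv k.+1 n = \sum_(i < n.+1) s i * conv k (n - i)%N.
Proof. by []. Qed.

Lemma fps_powS0 k : conv k.+1 0 = 0.
Proof. by rewrite fps_powS big_ord_recl big_ord0 abundancy0 mul0r addr0. Qed.

Lemma fps_pow1 n : conv 1 n = s n.
Proof.
rewrite fps_powS big_ord_recr /= subnn /fps_pow /= /fps_one eqxx mulr1.
rewrite big1 ?add0r // => i _.
by rewrite subn_eq0 leqNgt ltn_ord mulr0.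
Qed.

Lemma sum_ord_nat (f : nat -> R) n : f 0%N = 0 ->
  \sum_(i < n.+1) f i = \sum_(1 <= i < n.+1) f i.
Proof. by move=> f0; rewrite -(big_mkord xpredT f) big_ltn // f0 add0r. Qed.

Lemma fps_pow2_le n : conv 2 n <= 4 * n%:R.
Proof.
apply: le_trans (sum_abundancy_sqr R n).
rewrite -(@sum_ord_nat (fun i => s i ^+ 2)) ?abundancy0 ?expr0n //.
(* By a b <= (a^2 + b^2) / 2; the reflection i -> n - i then identifies the two halves. *)
have : conv 2 n <= \sum_(i < n.+1) (s i ^+ 2 / 2 + s (n - i)%N ^+ 2 / 2).
  rewrite fps_powS; apply: ler_sum => i _; rewrite fps_pow1.
  by have := sqr_ge0 (s i - s (n - i)%N); lra.
rewrite big_split /= [X in _ <= _ + X](reindex_inj rev_ord_inj) /=.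
under [X in _ <= _ + X]eq_bigr => i _ do rewrite subSS subKn -1?ltnS //.
rewrite -!mulr_suml; lra.
Qed.

(** Passing from n to n + 1 adds the partial sum of [s] up to n, at most 2 n <= (n + 1)^2 - n^2. *)
Lemma sum_abundancy_weighted n :
  \sum_(i < n.+1) s i * (n - i)%:R <= n%:R ^+ 2.
Proof.
elim: n => [|n IH]; first by rewrite big_ord_recl big_ord0 abundancy0 mul0r addr0 expr0n.
rewrite big_ord_recr /= subnn mulr0 addr0.
under eq_bigr => i _ do rewrite subSn -1?ltnS // -natr1 mulrDr mulr1.
rewrite big_split /= (@sum_ord_nat s) ?abundancy0 //.
have := sum_abundancy R n; rewrite -natr1; nra.
Qed.

Lemma fps_pow3_le n : conv 3 n <= 4 * n%:R ^+ 2.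
Proof.
apply: (@le_trans _ _ (4 * \sum_(i < n.+1) s i * (n - i)%:R)); last first.
  by rewrite ler_wpM2l // sum_abundancy_weighted.
rewrite fps_powS mulr_sumr; apply: ler_sum => i _.
by rewrite mulrCA ler_wpM2l ?abundancy_ge0 ?fps_pow2_le.
Qed.

Lemma sum_binomial k n : (\sum_(i < n) 'C(i, k) = 'C(n, k.+1))%N.
Proof.
elim: n => [|n IH]; first by rewrite big_ord0 bin0n.
by rewrite big_ord_recr /= IH binS.
Qed.

(** The binomial counts the compositions of n + 1 into k + 1 positive parts, and each contributes a
    product of values of [s], all at least 1. *)
Lemma binomial_le_fps_pow k n : 'C(n, k)%:R <= conv k.+1 n.+1.
Proof.
elim: k n => [|k IH] n; first by rewrite bin0 fps_pow1 abundancy_ge1.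
rewrite -sum_binomial natr_sum fps_powS big_ord_recl abundancy0 mul0r add0r.
rewrite big_ord_recr /= subnn.
rewrite [X in _ + s _ * X](_ : _ = 0) ?mulr0 ?addr0; last first.
  exact: fps_powS0.
rewrite (reindex_inj rev_ord_inj) /=; apply: ler_sum => i _.
rewrite /bump /= add1n subSS.
have {1}-> : (n - i = (n - i.+1).+1)%N by rewrite subnSK.
rewrite (le_trans (IH _)) // ler_peMl ?abundancy_ge1 //.
by apply: le_trans (IH _).
Qed.

Lemma abundancy_not_hurwitz n : (216 <= n)%N -> 215 <= s n ->
  ~ hurwitz (reduced_darcais R n).
Proof.
case: n => [//|n] n216 sn /hurwitz_minor [_].
rewrite !coef_reduced_darcais; do ?by lia.
rewrite fps_pow1.
have g2 := fps_pow2_le n.+1; have g3 := fps_pow3_le n.+1.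
have g4 := binomial_le_fps_pow 3 n.
have binE : 6 * 'C(n, 3)%:R = n%:R * (n%:R - 1) * (n%:R - 2) :> R.
  have n2 : (2 <= n)%N by lia.
  rewrite -(natrB R n2) -[1]/1%:R -(natrB R (ltnW n2)) -!natrM; congr (_%:R).
  by rewrite mulnC (bin_ffact n 3) !ffactnS ffactn0 muln1 -mulnA -!subn1 -subnDA.
have N215 : 215 <= n%:R :> R by rewrite (ler_nat R 215).
rewrite -[1`!]/1%N -[2`!]/2%N -[3`!]/6%N -[4`!]/24%N => minor.
rewrite -[n.+1%:R]natr1 in g2 g3.
have a0 : 0 <= conv 2 n.+1.
  by apply: le_trans (binomial_le_fps_pow 1 n).
have C0 : 0 <= 'C(n, 3)%:R :> R by [].
move: (n%:R : R) ('C(n, 3)%:R : R) C0 (s n.+1)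
  (conv 2 n.+1) (conv 3 n.+1)
  (conv 4 n.+1) sn g2 g3 g4 binE N215 minor a0.
move=> N C C0 a p2 p3 p4 sn g2 g3 g4 binE N215 minor a0.
have up : p2 * p3 <= 4 * (N + 1) * (4 * (N + 1) ^+ 2).
  apply: le_trans (ler_wpM2l a0 g3) _; apply: ler_wpM2r g2.
  by rewrite mulr_ge0 ?sqr_ge0.
have low : 215 * C <= a * p4 by apply: ler_pM.
have NN : 0 <= N * (N - 215) by apply: mulr_ge0; lra.
have NNN : 0 <= N ^+ 2 * (N - 215) by apply: mulr_ge0; [exact: sqr_ge0 | lra].
(* With N = n - 1 for the original n, clearing factorials in [minor] gives a p4 <= 2 p2 p3 <= 32 (N
   + 1)^3. Multiplying by 6, with p4 >= C, yields the constant 192 and the reverse of this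
   inequality. *)
have cubic : 192 * (N + 1) ^+ 3 < 215 * (N * (N - 1) * (N - 2)) by lra.
lra.
Qed.
End Coefficients.

Theorem mainTheorem2 (R : realType) :
  let l : nat := `|Num.ceil (expR (25046441%:R / 116352%:R : R))|%N in
  exists k : nat, (1 <= k <= l`!)%N /\ ~ hurwitz (reduced_darcais R k).
Proof.
move=> l; exists l`!; rewrite fact_gt0 leqnn; split=> //.
set x : R := 25046441%:R / 116352%:R in l *.
have x215 : 215 <= x by rewrite /x; lra.
have lx : expR x <= l%:R.
  by rewrite /l pmulrn gez0_abs ?ceil_ge // ceil_ge0 (lt_trans _ (expR_gt0 _)) // ltrN10.
have s215 : 215 <= abundancy R l`!.
  apply: le_trans x215 _; apply: le_trans (harmonic_le_abundancy_fact R l).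
  (* Compared after exponentiation: exp x <= l <= l + 1 <= exp of the harmonic sum. *)
  rewrite -ler_expR; apply: le_trans (expR_harmonic R l).
  by apply: le_trans lx _; rewrite ler_nat.
have l216 : (216 <= l)%N.
  rewrite -(ler_nat R); apply: le_trans lx; apply: le_trans (expR_ge1Dx _); lra.
have n216 : (216 <= l`!)%N by apply: leq_trans l216 (fact_geq _).
exact: abundancy_not_hurwitz n216 s215.
Qed.
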